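(* Let $r,n$ be integers with $2\leq r<n$, and let $G$ be a $K_{r+1}$-saturated graph with $n$ vertices. Then $$\rho(G) \ge \sqrt{\frac{(n-1)^2(r-1)+(r-1)^2(n-r+1)}{n}}.$$
   Context: All graphs are finite and undirected, with no loops or multiple edges. For a graph $H$, a graph $G$ is $H$-saturated if $G$ does not contain $H$ as a (not necessarily induced) subgraph but for every edge $e\in E(\overline{G})$ of the complement, $G+e$ contains $H$ as a subgraph. $K_{r+1}$ is the complete graph on $r+1$ vertices. The spectral radius $\rho(G)$ is the largest eigenvalue $\lambda_1(G)$ of the adjacency matrix of $G$. *)

(* Defs.v *)
From mathcomp Require Import all_boot all_order all_algebra.
From mathcomp Require Import classical_sets reals.

Set Implicit Arguments.
Unset Strict Implicit.
Unset Printing Implicit Defensive.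

Import Order.TTheory GRing.Theory Num.Theory.

Local Open Scope ring_scope.

Record sgraph (T : finType) := SGraph {
  adj :> rel T;
  adj_sym : symmetric adj;
  adj_irr : irreflexive adj }.

Definition complete_rel (T : finType) : rel T := fun x y => x != y.

Lemma complete_rel_sym (T : finType) : symmetric (@complete_rel T).
Proof. by move=> x y; rewrite /complete_rel eq_sym. Qed.

Lemma complete_rel_irr (T : finType) : irreflexive (@complete_rel T).
Proof. by move=> x; rewrite /complete_rel eqxx. Qed.

Definition complete_graph (k : nat) : sgraph 'I_k :=
  SGraph (@complete_rel_sym 'I_k) (@complete_rel_irr 'I_k).

Definition contains_subgraph (S T : finType) (H : sgraph S) (G : sgraph T) :=
  exists f : S -> T, injective f /\ forall x y, H x y -> G (f x) (f y).

(* The conjunct [x != y] only matters when [u = v], where no edge is added. *)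
Definition add_edge_rel (T : finType) (G : sgraph T) (u v : T) : rel T :=
  fun x y => G x y ||
    (x != y) && ((x == u) && (y == v) || (x == v) && (y == u)).

Lemma add_edge_rel_sym (T : finType) (G : sgraph T) (u v : T) :
  symmetric (add_edge_rel G u v).
Proof.
move=> x y; rewrite /add_edge_rel adj_sym eq_sym.
by rewrite orbC [(y == u) && _]andbC [(y == v) && _]andbC [in RHS]orbC
  [(x == v) && _ || _]orbC.
Qed.

Lemma add_edge_rel_irr (T : finType) (G : sgraph T) (u v : T) :
  irreflexive (add_edge_rel G u v).
Proof. by move=> x; rewrite /add_edge_rel adj_irr eqxx. Qed.

Definition add_edge (T : finType) (G : sgraph T) (u v : T) : sgraph T :=
  SGraph (add_edge_rel_sym G u v) (add_edge_rel_irr G u v).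

Definition saturated (S T : finType) (H : sgraph S) (G : sgraph T) :=
  ~ contains_subgraph H G /\
  forall u v : T, u != v -> ~~ G u v -> contains_subgraph H (add_edge G u v).

Definition adjacency_mx (R : realType) (T : finType) (G : sgraph T) :
    'M[R]_#|T| :=
  \matrix_(i, j) (G (enum_val i) (enum_val j))%:R.

(* A matrix has finitely many eigenvalues, so this supremum is a maximum as
   soon as there is an eigenvalue (see [spectral_radius_max]). *)
Definition spectral_radius (R : realType) (T : finType) (G : sgraph T) : R :=
  sup [set a : R | eigenvalue (adjacency_mx R G) a]%classic.

Lemma finite_max (R : realType) (s : seq R) (E : set R) (a : R) :
  (forall x, E x -> x \in s) -> E a ->
  exists2 m, E m & forall x, E x -> x <= m.
Proof.
elim: s E a => [|y s IH] E a Es Ea; first by have := Es _ Ea.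
have [[b [Eb /eqP by_]]|nE] := boolp.pselect (exists b, E b /\ b != y).
  have [||m [Em /eqP my] mP] := IH [set x | E x /\ x <> y]%classic b.
  - by move=> x [/Es + /eqP xy]; rewrite inE (negPf xy).
  - by [].
  have [[Ey ym]|nEy] := boolp.pselect (E y /\ m <= y).
    exists y => // x Ex; have [->//|/eqP xy] := eqVneq x y.
    by apply: le_trans ym; apply: mP.
  exists m => // x Ex; have [xy|/eqP xy] := eqVneq x y; last exact: mP.
  rewrite xy in Ex *; rewrite leNgt; apply/negP => /ltW my'.
  by apply: nEy.
exists a => // x Ex.
have -> : x = y by apply/eqP; apply: contra_notT nE => xy; exists x.
suff -> : a = y by [].
by apply/eqP; apply: contra_notT nE => xy; exists a.
Qed.

Lemma poly_roots_seq (R : realType) (p : {poly R}) :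
  p != 0 -> exists s : seq R, forall x, root p x -> x \in s.
Proof.
have [k] := ubnP (size p); elim: k p => // k IH p szp p0.
have [[a pa]|np] := boolp.pselect (exists a, root p a); last first.
  by exists [::] => x px; case: np; exists x.
have /factor_theorem[q pq] := pa.
have q0 : q != 0 by apply: contraNneq p0 => q0; rewrite pq q0 mul0r.
have [|s sP] := IH q _ q0.
  by move: szp; rewrite pq size_Mmonic ?monicXsubC // size_XsubC addn2.
exists (a :: s) => x; rewrite pq rootM root_XsubC inE => /orP[/sP->|->//].
by rewrite orbT.
Qed.

Lemma spectral_radius_max (R : realType) (T : finType) (G : sgraph T) (a : R) :
  eigenvalue (adjacency_mx R G) a ->
  eigenvalue (adjacency_mx R G) (spectral_radius R G) /\
  a <= spectral_radius R G.
Proof.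
set E := [set a : R | eigenvalue (adjacency_mx R G) a]%classic => Ea.
have [s sP] := poly_roots_seq (monic_neq0 (char_poly_monic (adjacency_mx R G))).
have [|m Em mP] := @finite_max R s E a _ Ea.
  by move=> x; rewrite /E /= eigenvalue_root_char => /sP.
have ubE : has_ubound E by exists m.
suff -> : spectral_radius R G = m by split; [exact: Em | exact: mP].
apply/eqP; rewrite eq_le; apply/andP; split.
  by apply: ge_sup; [exists a | exact: mP].
exact: ub_le_sup.
Qed.

(* Main.v *)
Require Import Defs.
From mathcomp Require Import all_boot all_order all_algebra.
From mathcomp Require Import classical_sets reals.
(* classical_sets shadows set0, subUset, setUC, ...: restore the finset ones. *)
From mathcomp Require Import fintype finset bigop.
From mathcomp Require Import ring lra zify.

(** The bound follows from rho(G)^2 n >= sum_v d(v)^2 and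
    sum_v d(v)^2 >= (n-1)^2(r-1) + (r-1)^2(n-r+1).
    The first is ||A 1|| <= rho ||1||, valid because the adjacency matrix A is
    nonnegative and symmetric. For the second, Bollobas' set-pairs inequality
    bounds the number of nonadjacent pairs of a graph in which each such pair
    has a k-clique in its common neighbourhood (Erdos-Hajnal-Moon). It is used
    for G with k = r-1 and, for every vertex y, with k = r-2 for the graph
    obtained from the link of y by joining the nonadjacent pairs {c, x} that
    have no (r-2)-clique in N(y) :&: N(c) :&: N(x). A nonadjacent pair {c, x}
    with an (r-1)-clique C in its common neighbourhood is joined in no link of
    a vertex of C, hence in at most codeg(c, x) - (r-1) links, and summing the
    edge bounds of the links over y gives a lower bound for the number
    sum_v d(v)^2 of walks of length 2. *)

Set Implicit Arguments.
Unset Strict Implicit.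
Unset Printing Implicit Defensive.

Import Order.TTheory GRing.Theory Num.Theory.

Local Open Scope ring_scope.

(** * Bollobas' set-pairs inequality *)

(** The [i]-th term is the probability that all of [A i] precedes all of [B i] in a random order of
    [X]; crossing intersections make these events exclusive. The induction conditions on the last
    element [x] of the order. *)
Lemma bollobas_set_pairs (F : numFieldType) (T I : finType) (X : {set T})
    (P : pred I) (A B : I -> {set T}) :
  (forall i, P i -> A i \subset X) -> (forall i, P i -> B i \subset X) ->
  (forall i, P i -> [disjoint A i & B i]) ->
  (forall i j, P i -> P j -> i != j -> ~~ [disjoint A i & B j]) ->
  \sum_(i | P i) ('C(#|A i| + #|B i|, #|A i|)%:R : F)^-1 <= 1.
Proof.
have [m] := ubnP #|X|.
elim: m X P A B => // m IH X P A B leXm AX BX AB0 ABij.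
(* An empty [B i] is disjoint from every [A j], so [i] is then the only index and its term is 1. The
   averaging below needs every [B i] nonempty. *)
have [/existsP[i /andP[Pi /eqP Bi0]]|nB0] :=
  boolP [exists i, P i && (B i == set0)].
  rewrite (bigD1 i) //= big1 ?addr0; last first.
    move=> j /andP[Pj ji]; have := ABij j i Pj Pi ji.
    by rewrite Bi0 disjoints_subset setC0 subsetT.
  by rewrite Bi0 cards0 addn0 binn invr1.
have Bgt0 i : P i -> (0 < #|B i|)%N.
  move=> Pi; rewrite card_gt0; apply: contraNN nB0 => Bi0.
  by apply/existsP; exists i; rewrite Pi.
have [/existsP[i0 Pi0]|noP] := boolP [exists i, P i]; last first.
  rewrite big_pred0 ?ler01 // => i.
  by apply/negbTE; apply: contraNN noP => Pi; apply/existsP; exists i.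
have X_gt0 : (0 < #|X|)%N.
  exact: leq_trans (Bgt0 _ Pi0) (subset_leq_card (BX _ Pi0)).
have step x : x \in X ->
    \sum_(i | P i && (x \notin A i))
       ('C(#|A i| + #|B i :\ x|, #|A i|)%:R : F)^-1 <= 1.
  move=> xX; apply: (IH (X :\ x)).
  - by have := cardsD1 x X; rewrite xX; lia.
  - by move=> i /andP[Pi xA]; rewrite subsetD1 AX.
  - by move=> i /andP[Pi xA]; rewrite setSD // BX.
  - by move=> i /andP[Pi xA]; apply: disjointWr (AB0 i Pi); apply: subD1set.
  - move=> i j /andP[Pi xA] /andP[Pj xAj] ij; have := ABij i j Pi Pj ij.
    apply: contraNN; rewrite !disjoints_subset => /subsetP AiB.
    apply/subsetP => y yA; have := AiB y yA; rewrite !inE.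
    by case: eqP => // yx; rewrite yx (negPf xA) in yA.
(* Induction is applied to the pairs (A i, B i :\ x) with x \notin A i, on the
   ground set X :\ x; averaging over x \in X reproduces the original sum. *)
have : \sum_(x in X) \sum_(i | P i && (x \notin A i))
       ('C(#|A i| + #|B i :\ x|, #|A i|)%:R : F)^-1 <= #|X|%:R.
  by rewrite -sumr_const; apply: ler_sum.
have -> : \sum_(x in X) \sum_(i | P i && (x \notin A i))
       ('C(#|A i| + #|B i :\ x|, #|A i|)%:R : F)^-1 =
    \sum_(i | P i) #|X|%:R * ('C(#|A i| + #|B i|, #|A i|)%:R : F)^-1.
  rewrite (exchange_big_dep P) /=; last by move=> x i _ /andP[].
  apply: eq_bigr => i Pi.
  rewrite (eq_bigl (mem (X :\: A i))); last first.
    by move=> x; rewrite !inE Pi andbC.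
  rewrite (big_setID (B i)) /=.
  have BXA : (X :\: A i) :&: B i = B i.
    apply/setIidPr/subsetP => x xB; rewrite inE (subsetP (BX i Pi)) // andbT.
    by rewrite (disjointFl (AB0 i Pi) xB).
  rewrite BXA.
  have [a aE] : exists a, a = #|A i| by eexists.
  have [b bE] : exists b, #|B i| = b.+1.
    by exists #|B i|.-1; rewrite prednK ?Bgt0.
  rewrite -aE bE.
  rewrite (eq_bigr (fun=> ('C(a + b, a)%:R : F)^-1)); last first.
    by move=> x xB; have := cardsD1 x (B i); rewrite xB bE add1n => -[<-].
  rewrite [X in _ + X](eq_bigr (fun=> ('C(a + b.+1, a)%:R : F)^-1)); last first.
    move=> x; rewrite inE => /andP[xB _].
    rewrite (setDidPl _) ?bE //.
    by rewrite disjoint_sym disjoints1.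
  rewrite !sumr_const.
  have cX : #|X| = (a + b.+1 + #|(X :\: A i) :\: B i|)%N.
    have := cardsID (A i) X; rewrite (setIidPr (AX i Pi)).
    by have := cardsID (B i) (X :\: A i); rewrite BXA; lia.
  rewrite cX bE natrD mulrDl; congr (_ + _); last by rewrite mulr_natl.
  rewrite -[LHS]mulr_natl.
  (* The [b.+1] elements of [B i] also make up for the skipped elements of [A i]: together they give
     [a + b.+1] times the original term. *)
  have key : ((a + b.+1) * 'C(a + b, a) = b.+1 * 'C(a + b.+1, a))%N.
    by have := mul_bin_down (a + b.+1) a; rewrite addnS /= -addnS addKn.
  have C1 : ('C(a + b, a)%:R : F) != 0 by rewrite pnatr_eq0 -lt0n bin_gt0; lia.
  have C2 : ('C(a + b.+1, a)%:R : F) != 0 by rewrite pnatr_eq0 -lt0n bin_gt0; lia.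
  apply/eqP; rewrite eqr_div //; apply/eqP.
  by rewrite -!natrM key.
rewrite -mulr_sumr -ler_pdivlMl ?ltr0n // mulVf // pnatr_eq0; lia.
Qed.

(** * Counting edges when nonadjacent pairs have common cliques *)

Definition clique (T : finType) (E : rel T) (C : {set T}) :=
  [forall x in C, forall y in C, (x != y) ==> E x y].

(** Joining [u] to [v] would create a clique on [k + 2] vertices; [S] confines its other [k]
    vertices, so that the notion also applies inside a link. *)
Definition completable (T : finType) (E : rel T) (S : {set T}) (k : nat)
    (u v : T) :=
  [exists C : {set T}, [&& C \subset S, #|C| == k, clique E C
                         & [forall x in C, E u x && E v x]]].

Lemma completableP (T : finType) (E : rel T) (S : {set T}) k u v :
  reflect (exists C : {set T}, [/\ C \subset S, #|C| = k,
     {in C &, forall x y, x != y -> E x y} & {in C, forall x, E u x /\ E v x}])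
    (completable E S k u v).
Proof.
apply: (iffP existsP) => -[C].
  case/and4P => CS /eqP Ck /forall_inP cC /forall_inP uvC; exists C; split=> //.
    by move=> x y xC yC; apply/implyP; move: y yC; apply/forall_inP/cC.
  by move=> x /uvC/andP[].
case=> CS Ck cC uvC; exists C; apply/and4P; split=> //; first exact/eqP.
  by apply/forall_inP => x xC; apply/forall_inP => y yC; apply/implyP/cC.
by apply/forall_inP => x /uvC[-> ->].
Qed.

(* Set pairs: a nonadjacent pair A = {u, v} against B A = S :\: (A :|: C), where
   C completes A. No other nonadjacent pair lies inside A :|: C, so it meets
   B A. *)
Lemma card_nonedges_le (T : finType) (E : rel T) (S : {set T}) (k : nat) :
  symmetric E -> irreflexive E ->
  {in S &, forall u v, u != v -> ~~ E u v -> completable E S k u v} ->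
  (#|[set p in setX S S | (p.1 != p.2) && ~~ E p.1 p.2]|
     <= (#|S| - k).-1 * (#|S| - k))%N.
Proof.
move=> Esym Eirr sat; set N := [set p in _ | _].
pose f (p : T * T) := [set p.1; p.2].
pose P := f @: N.
have PP A : A \in P -> exists u v, [/\ A = [set u; v], u \in S, v \in S,
    u != v & ~~ E u v].
  case/imsetP => -[u v]; rewrite !inE /= => /and3P[/andP[uS vS] uv nE] ->.
  by exists u, v.
have /fin_all_exists[B BP] A : exists B : {set T}, A \in P ->
    [/\ B \subset S, (2 + #|B| = #|S| - k)%N, [disjoint A & B]
      & {in P, forall A', A' != A -> ~~ [disjoint A' & B]}].
  have [AP|] := boolP (A \in P); last by exists set0.
  have [u [v [-> uS vS uv nE]]] := PP A AP.
  have /completableP[C [CS Ck cC uvC]] := sat u v uS vS uv nE.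
  have uC : u \notin C by apply/negP => /uvC[]; rewrite Eirr.
  have vC : v \notin C by apply/negP => /uvC[_]; rewrite Eirr.
  exists (S :\: (u |: (v |: C))) => _; split.
  - exact: subsetDl.
  - rewrite cardsD (setIidPr _); last by rewrite !subUset !sub1set uS vS.
    have : (#|u |: (v |: C)| <= #|S|)%N.
      by apply: subset_leq_card; rewrite !subUset !sub1set uS vS.
    by rewrite !cardsU1 !inE (negPf uv) (negPf uC) vC Ck /=; lia.
  - by rewrite -setI_eq0; apply/eqP/setP => x; rewrite !inE; do 2 case: eqP.
  - move=> A' /PP[u' [v' [-> u'S v'S u'v' nE']]].
    apply: contraNN => /pred0P dis.
    have inW x : x \in S -> x \in [set u'; v'] -> x \in u |: (v |: C).
      by move=> xS xA; have := dis x; rewrite /= xA inE xS andbT /= => /negbFE.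
    have := inW u' u'S; have := inW v' v'S; rewrite !inE !eqxx orbT /=.
    move=> /(_ isT) v'W /(_ isT) u'W.
    case/or3P: u'W v'W u'v' nE' => [/eqP->|/eqP->|u'C] /or3P[/eqP->|/eqP->|v'C];
      rewrite ?eqxx // => u'v' nE'.
    + by case/uvC: v'C => vE; rewrite vE in nE'.
    + by rewrite setUC.
    + by case/uvC: v'C => _ vE; rewrite vE in nE'.
    + by case/uvC: u'C => + _; rewrite Esym => vE; rewrite vE in nE'.
    + by case/uvC: u'C => _; rewrite Esym => vE; rewrite vE in nE'.
    + by rewrite cC in nE'.
have cardP2 A : A \in P -> #|A| = 2%N.
  by case/PP => u [v [-> _ _ uv _]]; rewrite cards2 uv.
have leP : (#|P| <= 'C(#|S| - k, 2))%N.
  have [->|[A0 A0P]] := set_0Vmem P; first by rewrite cards0.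
  have := @bollobas_set_pairs rat T {set T} S (mem P) id B.
  rewrite (eq_bigr (fun=> ('C(#|S| - k, 2)%:R : rat)^-1)); last first.
    by move=> A AP; have [_ <- _ _] := BP A AP; rewrite cardP2.
  rewrite sumr_const -[_ *+ #|P|]mulr_natl => H.
  have Cgt0 : (0 < 'C(#|S| - k, 2)%:R :> rat).
    by rewrite ltr0n bin_gt0; have [_ <-] := BP A0 A0P.
  rewrite -(ler_nat rat) -[leRHS]mul1r -ler_pdivrMr //; apply: H.
  - by move=> A /PP[u [v [-> uS vS _ _]]]; rewrite subUset !sub1set uS vS.
  - by move=> A /BP[].
  - by move=> A /BP[].
  - by move=> A A' AP /BP[_ _ _ disP] AA'; exact: disP.
(* [N] consists of ordered pairs, so each set in [P] comes from at most two of them. *)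
rewrite -sum1_card (partition_big f (mem P)) /=; last first.
  by move=> p pN; apply: imset_f.
have -> : ((#|S| - k).-1 * (#|S| - k) = 'C(#|S| - k, 2) * 2)%N.
  by rewrite mulnC [RHS]mulnC mul_bin_left bin1 subn1 mulnC.
apply: leq_trans (leq_mul leP (leqnn 2)); rewrite -sum_nat_const.
apply: leq_sum => A /PP[u [v [-> _ _ uv _]]].
rewrite sum1_card -[leqRHS]/(true + true)%N.
apply: (@leq_trans #|[set (u, v); (v, u)]|); last by rewrite cards2; case: eqP.
apply: subset_leq_card; apply/subsetP => -[x y]; case/andP.
rewrite !inE /= => /and3P[_ xy _] /eqP/setP fE.
have := fE x; have := fE y; rewrite !inE !eqxx orbT /= => /esym yE /esym xE.
rewrite !xpair_eqE; move: xy.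
by case/orP: xE => /eqP->; case/orP: yE => /eqP->; rewrite !eqxx // orbT.
Qed.

(** With s = |S|, subtract the nonadjacent ordered pairs from all s(s-1): s(s-1) - (s-k)(s-k-1) =
    2sk - k^2 - k. *)
Lemma sum_degrees_ge (R : realDomainType) (T : finType) (E : rel T)
    (S : {set T}) (k : nat) :
  symmetric E -> irreflexive E ->
  {in S &, forall u v, u != v -> ~~ E u v -> completable E S k u v} ->
  2 * #|S|%:R * k%:R - k%:R ^+ 2 - k%:R
    <= \sum_(u in S) \sum_(v in S) (E u v)%:R :> R.
Proof.
move=> Esym Eirr sat; have := card_nonedges_le Esym Eirr sat.
set N := [set p in _ | _] => leN.
have sumE : \sum_(u in S) \sum_(v in S) (E u v)%:R =
    #|S|%:R ^+ 2 - #|S|%:R - #|N|%:R :> R.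
  have -> : #|N|%:R = \sum_(u in S) \sum_(v in S) ((u != v) && ~~ E u v)%:R :> R.
    rewrite pair_big_dep -sum1_card natr_sum /= big_mkcond [RHS]big_mkcond.
    apply: eq_bigr => -[u v] _; rewrite !inE /=.
    by case: ((u \in S) && (v \in S)); case: (_ && ~~ _).
  have -> : #|S|%:R ^+ 2 - #|S|%:R = \sum_(u in S) \sum_(v in S) (u != v)%:R :> R.
    under eq_bigr => u uS.
      rewrite (bigD1 u) //= eqxx add0r (eq_bigr (fun=> 1)); last first.
        by move=> v /andP[_]; rewrite eq_sym => ->.
      have -> : \sum_(i in S | i != u) 1 = #|S|%:R - 1 :> R.
        by rewrite -[#|S|%:R]sumr_const [in RHS](bigD1 u) //= addrAC subrr add0r.
      over.
    by rewrite sumr_const -mulr_natl; ring.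
  rewrite -sumrB; apply: eq_bigr => u _; rewrite -sumrB; apply: eq_bigr => v _.
  by case: eqP => [->|_] /=; rewrite ?Eirr; case: (E u v); rewrite ?subrr ?subr0.
have : #|N|%:R <= (#|S|%:R - k%:R) * (#|S|%:R - k%:R - 1) :> R.
  (* If [#|S| <= k], truncated subtraction forces [N] to be empty, while both factors on the right
     are nonpositive. *)
  have [lekS|ltSk] := ltnP k #|S|; last first.
    have -> : #|N| = 0%N by apply/eqP; rewrite -leqn0 (leq_trans leN) //; nia.
    by rewrite -(ler_nat R) in ltSk; nra.
  have := leN; rewrite -(ler_nat R) natrM -subn1 !natrB ?subn_gt0 //; last lia.
  by rewrite mulrC.
by rewrite sumE; nra.
Qed.

(** * Lower bound for the sum of squared degrees *)

Lemma sum_sq_degrees_ge (R : realDomainType) (T : finType) (E : rel T) (k : nat)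
    (n := #|T|%:R : R) (d := fun y => \sum_z (E y z)%:R : R) :
  symmetric E -> irreflexive E ->
  (forall u v, u != v -> ~~ E u v -> completable E setT k.+1 u v) ->
  (n - 1) ^+ 2 * k.+1%:R + k.+1%:R ^+ 2 * (n - k.+1%:R) <= \sum_y d y ^+ 2.
Proof.
move=> Esym Eirr sat.
(* [H y] is the link of y plus the nonadjacent pairs of [link y] having no
   common k-clique inside [link y]; so all its nonadjacent pairs are
   completable. *)
pose link y := [set z | E y z].
pose H y c x := (c != x) && (E c x || ~~ completable E (link y) k c x).
have Hsym y : symmetric (H y).
  have csym c x : completable E (link y) k c x -> completable E (link y) k x c.
    case/completableP => C [CS Ck cC cxC]; apply/completableP; exists C.
    by split=> // z /cxC[].
  move=> c x; rewrite /H eq_sym Esym; congr (_ && (_ || ~~ _)).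
  by apply/idP/idP; apply: csym.
have Hirr y : irreflexive (H y) by move=> c; rewrite /H eqxx.
have HE y c x : E c x -> H y c x.
  by rewrite /H => cx; rewrite cx andbT; apply: contraTneq cx => ->; rewrite Eirr.
have linkE y : #|link y|%:R = d y.
  rewrite -sum1_card natr_sum big_mkcond; apply: eq_bigr => z _.
  by rewrite inE; case: (E y z).
have leH y : 2 * d y * k%:R - k%:R ^+ 2 - k%:R
    <= \sum_c \sum_x ([&& E y c, E y x & H y c x])%:R.
  rewrite -linkE; apply: le_trans (sum_degrees_ge R (Hsym y) (Hirr y) _) _.
    move=> u v _ _ uv; rewrite /H uv /= negb_or negbK => /andP[_].
    case/completableP => C [CS Ck cC uvC]; apply/completableP; exists C.
    by split=> // [z t zC tC /(cC z t zC tC)|z /uvC[]];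
      [exact: HE | split; exact: HE].
  rewrite big_mkcond le_eqVlt; apply/orP; left; apply/eqP; apply: eq_bigr => c _.
  rewrite inE; case: (E y c) => /=; last by rewrite big1.
  rewrite big_mkcond; apply: eq_bigr => x _.
  by rewrite inE; case: (E y x).
(* A nonadjacent pair {c, x} completed by C is an edge of [H y] for no y \in C,
   hence for at most codeg(c, x) - k.+1 vertices y. *)
have leC c x : \sum_y ([&& E y c, E y x & H y c x])%:R
    + k.+1%:R * (1 - (c == x)%:R - (E c x)%:R) + (c == x)%:R * d c
    <= \sum_y (E y c)%:R * (E y x)%:R :> R.
  (* On the diagonal [H y] counts nothing, and the closed walks c-y-c account for [d c]. *)
  have [<-|cx] := eqVneq c x.
    rewrite Eirr mul1r subrr subr0 mulr0 addr0 big1 ?add0r; last first.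
      by move=> y _; rewrite Hirr !andbF.
    by apply: ler_sum => y _; rewrite Esym; case: (E y c); rewrite ?mulr1 ?mulr0.
  rewrite mul0r addr0 subr0.
  have [cEx|ncEx] := boolP (E c x).
    rewrite subrr mulr0 addr0; apply: ler_sum => y _.
    rewrite -natrM mulnb ler_nat.
    by case: (E y c); case: (E y x) => //=; case: (H y c x).
  rewrite subr0 mulr1.
  have /completableP[C [_ Ck cC cxC]] := sat c x cx ncEx.
  have -> : k.+1%:R = \sum_y (y \in C)%:R :> R.
    rewrite -Ck -sum1_card natr_sum big_mkcond; apply: eq_bigr => y _.
    by case: (y \in C).
  rewrite -big_split; apply: ler_sum => y _ /=; rewrite -natrM mulnb -natrD ler_nat.
  have [yC|_] := boolP (y \in C); last first.
    by rewrite addn0; case: (E y c); case: (E y x) => //=; case: (H y c x).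
  have [yc yx] := cxC y yC; rewrite ![E y _]Esym yc yx /= /H cx (negPf ncEx) /=.
  (* C :\ y completes {c, x} inside [link y], so y is not counted by H. *)
  suff -> : completable E (link y) k c x by [].
  apply/completableP; exists (C :\ y); split.
  - apply/subsetP => z; rewrite !inE => /andP[zy zC].
    by apply: cC => //; rewrite eq_sym.
  - by have := cardsD1 y C; rewrite yC Ck => -[].
  - by move=> z t; rewrite !inE => /andP[_ zC] /andP[_ tC]; apply: cC.
  - by move=> z; rewrite !inE => /andP[_ /cxC].
have sumd : 2 * n * k.+1%:R - k.+1%:R ^+ 2 - k.+1%:R <= \sum_y d y.
  have := @sum_degrees_ge R T E setT k.+1 Esym Eirr.
  rewrite cardsT => degs; rewrite /d; apply: le_trans (degs _) _.
    by move=> u v _ _; apply: sat.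
  rewrite le_eqVlt; apply/orP; left; apply/eqP.
  by apply: eq_big => [u|u _]; [|apply: eq_bigl => v]; rewrite inE.
have sumH : \sum_y (2 * d y * k%:R - k%:R ^+ 2 - k%:R) =
    2 * k%:R * (\sum_y d y) - n * (k%:R ^+ 2 + k%:R).
  rewrite (eq_bigr (fun y => 2 * k%:R * d y - (k%:R ^+ 2 + k%:R)));
    last by move=> y _; ring.
  by rewrite sumrB -mulr_sumr sumr_const -[_ *+ #|_|]mulr_natl.
have leS : \sum_y (2 * d y * k%:R - k%:R ^+ 2 - k%:R)
    <= \sum_y \sum_c \sum_x ([&& E y c, E y x & H y c x])%:R.
  by apply: ler_sum => y _; apply: leH.
have leSC : \sum_c \sum_x (\sum_y ([&& E y c, E y x & H y c x])%:R
    + k.+1%:R * (1 - (c == x)%:R - (E c x)%:R) + (c == x)%:R * d c)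
    <= \sum_c \sum_x \sum_y (E y c)%:R * (E y x)%:R :> R.
  by apply: ler_sum => c _; apply: ler_sum => x _; apply: leC.
have swap (F : T -> T -> T -> R) :
    \sum_c \sum_x \sum_y F c x y = \sum_y \sum_c \sum_x F c x y.
  rewrite exchange_big [RHS]exchange_big [LHS]exchange_big; apply: eq_bigr => c _.
  by rewrite exchange_big.
have sqE : \sum_c \sum_x \sum_y (E y c)%:R * (E y x)%:R = \sum_y d y ^+ 2 :> R.
  rewrite swap; apply: eq_bigr => y _; rewrite expr2 /d mulr_suml.
  by apply: eq_bigr => c _; rewrite mulr_sumr.
have splitE : \sum_c \sum_x (\sum_y ([&& E y c, E y x & H y c x])%:R
    + k.+1%:R * (1 - (c == x)%:R - (E c x)%:R) + (c == x)%:R * d c) =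
  \sum_y \sum_c \sum_x ([&& E y c, E y x & H y c x])%:R
    + k.+1%:R * (n ^+ 2 - n - \sum_y d y) + \sum_y d y :> R.
  rewrite -swap; under eq_bigr => c _ do rewrite !big_split /=.
  rewrite !big_split /=; congr (_ + _ + _).
    have -> : n ^+ 2 - n - \sum_y d y = \sum_c (n - 1 - d c) :> R.
      by rewrite !sumrB !sumr_const -[n *+ _]mulr_natl -expr2.
    rewrite mulr_sumr; apply: eq_bigr => c _; rewrite -mulr_sumr; congr (_ * _).
    rewrite !sumrB sumr_const; congr (_ - _ - _).
    by rewrite (bigD1 c) //= eqxx big1 ?addr0 // => x; rewrite eq_sym => /negPf->.
  apply: eq_bigr => c _; rewrite (bigD1 c) //= eqxx mul1r big1 ?addr0 //.
  by move=> x; rewrite eq_sym => /negPf->; rewrite mul0r.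
rewrite sqE splitE in leSC; rewrite sumH in leS.
(* Eliminating [S3] leaves the degree sum with coefficient 2k - (k+1) + 1 = k, so [sumd] enters
   multiplied by [k]. *)
have := ler_wpM2l (ler0n R k) sumd.
move: leS leSC; set S1 := \sum_y d y ^+ 2; set S2 := \sum_y d y.
set S3 := \sum_y _; rewrite -natr1. lra.
Qed.

(** * Quadratic forms and the largest eigenvalue *)

(** The bilinear form of [M]; [mxform 1%:M x x] serves as the squared Euclidean norm. *)
Definition mxform (R : comNzRingType) m (M : 'M[R]_m) (x y : 'rV[R]_m) : R :=
  (x *m M *m y^T) 0 0.

Lemma mxformE (R : comNzRingType) m (M : 'M[R]_m) (x y : 'rV[R]_m) :
  mxform M x y = \sum_i \sum_j x 0 i * M i j * y 0 j.
Proof.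
rewrite /mxform mxE exchange_big; apply: eq_bigr => j _.
by rewrite !mxE mulr_suml.
Qed.

Lemma mxformC (R : comNzRingType) m (M : 'M[R]_m) (x y : 'rV[R]_m) :
  M^T = M -> mxform M x y = mxform M y x.
Proof.
by move=> MT; rewrite /mxform -[x *m M *m y^T]trmxK mxE !trmx_mul MT trmxK mulmxA.
Qed.

Lemma mxform_addZ (R : comNzRingType) m (M : 'M[R]_m) (x y : 'rV[R]_m) (t : R) :
  M^T = M ->
  mxform M (x + t *: y) (x + t *: y) =
  mxform M x x + 2 * t * mxform M x y + t ^+ 2 * mxform M y y.
Proof.
move=> MT; have yx := mxformC y x MT; move: yx; rewrite /mxform linearD linearZ /=.
rewrite !mulmxDl !mulmxDr -!scalemxAl -!scalemxAr ?scalerA.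
by rewrite !mxE => ->; ring.
Qed.

Lemma mxform1E (R : comNzRingType) m (x : 'rV[R]_m) :
  mxform 1%:M x x = \sum_i x 0 i ^+ 2.
Proof. by rewrite /mxform mulmx1 mxE; apply: eq_bigr => i _; rewrite mxE expr2. Qed.

Lemma mxform1_ge0 (R : realDomainType) m (x : 'rV[R]_m) : 0 <= mxform 1%:M x x.
Proof. by rewrite mxform1E sumr_ge0 // => i _; rewrite sqr_ge0. Qed.

Lemma mxform_bounded (R : realFieldType) m (M : 'M[R]_m) :
  exists2 c, 0 < c & forall x, `|mxform M x x| <= c * mxform 1%:M x x.
Proof.
exists (1 + \sum_i \sum_j `|M i j|).
  by rewrite ltr_wpDr // sumr_ge0 // => i _; rewrite sumr_ge0.
move=> x; rewrite mulrDl mul1r; apply: ler_wpDl; first exact: mxform1_ge0.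
rewrite mxformE mulr_suml (le_trans (ler_norm_sum _ _ _)) //; apply: ler_sum => i _.
rewrite mulr_suml (le_trans (ler_norm_sum _ _ _)) //; apply: ler_sum => j _.
rewrite !normrM -mulrA mulrCA ler_wpM2l //.
have le1 l : `|x 0 l| ^+ 2 <= mxform 1%:M x x.
  rewrite mxform1E (bigD1 l) //= real_normK ?num_real // lerDl.
  by rewrite sumr_ge0 // => ? _; rewrite sqr_ge0.
by have := le1 i; have := le1 j; have := sqr_ge0 (`|x 0 i| - `|x 0 j|); nra.
Qed.

(** The eigenvalue is the supremum of the Rayleigh quotient, taken as the infimum of its upper
    bounds [U]; singularity of [A - l%:M] stands in for a maximising vector. *)
Lemma max_eigenvalue_form (R : realType) m (A : 'M[R]_m) :
  (0 < m)%N -> A^T = A ->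
  exists2 l, eigenvalue A l & forall x, mxform A x x <= l * mxform 1%:M x x.
Proof.
move=> m_gt0 AT.
pose U := [set t : R | forall x, mxform A x x <= t * mxform 1%:M x x]%classic.
have [c c_gt0 cP] := mxform_bounded A.
have Uc : U c by move=> x; apply: le_trans (cP x); apply: ler_norm.
have lbU x : 0 < mxform 1%:M x x -> lbound U (mxform A x x / mxform 1%:M x x).
  by move=> x_gt0 t Ut; rewrite ler_pdivrMr //; apply: Ut.
have Uinf : has_inf U.
  split; first by exists c.
  have z_gt0 : 0 < mxform 1%:M (const_mx 1 : 'rV[R]_m) (const_mx 1).
    rewrite mxform1E (eq_bigr (fun=> 1)); last by move=> i _; rewrite mxE expr1n.
    by rewrite sumr_const card_ord ltr0n.
  by exists (mxform A (const_mx 1) (const_mx 1)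
    / mxform 1%:M (const_mx 1 : 'rV[R]_m) (const_mx 1)); apply: lbU.
have UinfP x : mxform A x x <= inf U * mxform 1%:M x x.
  have := mxform1_ge0 x; rewrite le_eqVlt => /orP[/eqP x0|x_gt0].
    by have := Uc x; rewrite -x0 !mulr0.
  by rewrite -ler_pdivrMr //; apply: lb_le_inf; [exists c | exact: lbU].
exists (inf U) => //; set l := inf U in UinfP *.
apply: contraT; rewrite /eigenvalue negbK kermx_eq0 row_free_unit => Munit.
set M := A - l%:M in Munit.
have MT : M^T = M by rewrite /M linearB /= AT tr_scalar_mx.
have ME x : mxform M x x = mxform A x x - l * mxform 1%:M x x.
  rewrite /mxform /M mulmxBr mulmxBl mul_mx_scalar mulmx1 -scalemxAl.
  by rewrite !mxE.
have [e e_gt0 eP] := mxform_bounded (invmx M).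
(* M is negative semidefinite; if it were invertible, evaluating it at
   x + e^-1 x M^-1 would give x M x^T <= - e^-1 x x^T, so that l - e^-1 would
   still be an upper bound. *)
suff : U (l - e^-1).
  move=> /(ge_inf Uinf.2); rewrite -/l lerDl oppr_ge0 invr_le0 leNgt.
  by rewrite e_gt0.
move=> x.
have := ME (x + e^-1 *: (x *m invmx M)).
rewrite mxform_addZ //.
have -> : mxform M x (x *m invmx M) = mxform 1%:M x x.
  by rewrite mxformC // /mxform mulmxKV // mulmx1.
have -> : mxform M (x *m invmx M) (x *m invmx M) = mxform (invmx M) x x.
  by rewrite [LHS]/mxform mulmxKV // -/(mxform _ _ _) trmx_mul trmx_inv MT mulmxA.
have := UinfP (x + e^-1 *: (x *m invmx M)).
have := eP x; rewrite ler_norml => /andP[eP1 eP2]; rewrite ME.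
set a := mxform A x x; set b := mxform 1%:M x x in eP1 eP2 *.
set f := mxform _ x x in eP1 eP2 *.
move=> H1 H2.
(* The cross term contributes 2b/e and the last term at least -b/e, which leaves the gain b/e. *)
have : e^-1 ^+ 2 * (- (e * b)) <= e^-1 ^+ 2 * f.
  by apply: ler_wpM2l => //; apply: sqr_ge0.
have -> : e^-1 ^+ 2 * (- (e * b)) = - (e^-1 * b) by field; rewrite gt_eqF.
by nra.
Qed.

(** As [x] and its entrywise absolute value have the same norm, an upper bound on the form becomes a
    two-sided one: no negative eigenvalue exceeds the largest one in modulus. *)
Lemma mxform_absr (R : realDomainType) m (A : 'M[R]_m) (x : 'rV[R]_m) :
  (forall i j, 0 <= A i j) ->
  `|mxform A x x| <= mxform A (\row_i `|x 0 i|) (\row_i `|x 0 i|).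
Proof.
move=> A_ge0; rewrite !mxformE (le_trans (ler_norm_sum _ _ _)) //.
apply: ler_sum => i _; rewrite (le_trans (ler_norm_sum _ _ _)) //.
by apply: ler_sum => j _; rewrite !mxE !normrM (ger0_norm (A_ge0 i j)).
Qed.

Lemma nonneg_mx_eigenvalue (R : realType) m (A : 'M[R]_m) :
  (0 < m)%N -> A^T = A -> (forall i j, 0 <= A i j) ->
  exists l, [/\ eigenvalue A l, 0 <= l & forall z : 'rV[R]_m,
    mxform 1%:M (z *m A) (z *m A) <= l ^+ 2 * mxform 1%:M z z].
Proof.
move=> m_gt0 AT A_ge0; have [l Al lP] := max_eigenvalue_form m_gt0 AT.
have absP x : `|mxform A x x| <= l * mxform 1%:M x x.
  apply: le_trans (mxform_absr x A_ge0) (le_trans (lP _) _).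
  rewrite !mxform1E le_eqVlt; apply/orP; left; apply/eqP; congr (_ * _).
  by apply: eq_bigr => i _; rewrite mxE real_normK ?num_real.
have l_ge0 : 0 <= l.
  have /eigenvalueP[v _ v_neq0] := Al.
  have v_gt0 : 0 < mxform 1%:M v v.
    rewrite lt_neqAle mxform1_ge0 andbT eq_sym; apply: contraNneq v_neq0.
    rewrite mxform1E => /psumr_eq0P v0; apply/eqP/rowP => i; rewrite mxE.
    by apply/eqP; rewrite -sqrf_eq0 v0 // => j _; rewrite sqr_ge0.
  by rewrite -(pmulr_lge0 _ v_gt0); apply: le_trans (absP v).
exists l; split=> // z; set w := z *m A.
have wz : mxform A w z = mxform 1%:M w w.
  by rewrite /mxform mulmx1 -mulmxA; congr ((_ *m _) 0 0); rewrite /w trmx_mul AT.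
have tT : (1%:M : 'M[R]_m)^T = 1%:M by rewrite trmx1.
(* Polarisation: add the bounds on the forms of w + t z and w - t z. *)
have key t : 2 * t * mxform 1%:M w w
    <= l * (mxform 1%:M w w + t ^+ 2 * mxform 1%:M z z).
  have := absP (w + t *: z); have := absP (w + (- t) *: z).
  rewrite !mxform_addZ // wz !ler_norml => /andP[H1 _] /andP[_ H2].
  by lra.
(* The choice [t = l] balances [key] after division by [l]; if [l = 0], already [t = 1] forces [w]
   to have norm 0. *)
have := l_ge0; rewrite le_eqVlt => /orP[/eqP l0|l_gt0].
  by have := key 1; rewrite -l0; lra.
by have := key l => keyl; rewrite -(ler_pM2l l_gt0); lra.
Qed.

(** * Spectral radius, degrees and saturation *)

(** The all-ones vector has squared norm [#|T|] and is mapped by the adjacency matrix to the degree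
    sequence. *)
Lemma sum_sq_degrees_le (R : realType) (T : finType) (G : sgraph T) :
  (0 < #|T|)%N ->
  0 <= spectral_radius R G /\
  \sum_y (\sum_z (G y z)%:R) ^+ 2 <= spectral_radius R G ^+ 2 * #|T|%:R.
Proof.
move=> T_gt0; set A := adjacency_mx R G.
have AT : A^T = A by apply/matrixP => i j; rewrite !mxE adj_sym.
have [|l [Al l_ge0 lP]] := nonneg_mx_eigenvalue T_gt0 AT.
  by move=> i j; rewrite mxE ler0n.
have [_ lle] := spectral_radius_max Al.
split; first exact: le_trans lle.
have := lP (const_mx 1); rewrite !mxform1E.
have -> : \sum_i (const_mx 1 : 'rV[R]_#|T|) 0 i ^+ 2 = #|T|%:R.
  rewrite (eq_bigr (fun=> 1)); last by move=> i _; rewrite mxE expr1n.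
  by rewrite sumr_const card_ord.
have reidx (F : T -> R) : \sum_y F y = \sum_(i < #|T|) F (enum_val i).
  exact: reindex (onW_bij _ (enum_val_bij T)).
have -> : \sum_i ((const_mx 1 : 'rV[R]_#|T|) *m A) 0 i ^+ 2 =
    \sum_y (\sum_z (G y z)%:R) ^+ 2.
  rewrite [RHS]reidx; apply: eq_bigr => i _; rewrite mxE reidx; congr (_ ^+ 2).
  by apply: eq_bigr => j _; rewrite !mxE mul1r adj_sym.
move=> H; apply: le_trans H _; rewrite ler_wpM2r ?ler0n //.
by rewrite lerXn2r // nnegrE // (le_trans l_ge0).
Qed.

(** A copy of the complete graph in [G] plus [uv] must use the new edge, hence both [u] and [v]; its
    other r - 1 vertices are the required clique. *)
Lemma saturated_completable (T : finType) (G : sgraph T) (r : nat) (u v : T) :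
  saturated (complete_graph r.+1) G -> u != v -> ~~ G u v ->
  completable G setT r.-1 u v.
Proof.
case=> freeG satG uv nuv; have [f [f_inj fE]] := satG u v uv nuv.
have [i fi] : exists i, f i = u.
  have [/existsP[i /eqP fi]|] := boolP [exists i, f i == u]; first by exists i.
  rewrite negb_exists => /forallP nu; case: freeG; exists f; split=> // x y /fE /=.
  by rewrite /add_edge_rel !(negPf (nu _)) !(andbF, andFb) orbF.
have [j fj] : exists j, f j = v.
  have [/existsP[j /eqP fj]|] := boolP [exists j, f j == v]; first by exists j.
  rewrite negb_exists => /forallP nv; case: freeG; exists f; split=> // x y /fE /=.
  by rewrite /add_edge_rel !(negPf (nv _)) !(andbF, andFb) orbF.
have ij : i != j by apply: contraNneq uv => ij; rewrite -fi ij fj.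
apply/completableP; exists (f @: ([set~ i] :\ j)); split.
- by apply/subsetP => x; rewrite inE.
- rewrite card_imset //; have := cardsC1 i; have := cardsD1 j [set~ i].
  by rewrite card_ord !inE eq_sym ij /=; lia.
- move=> _ _ /imsetP[x + ->] /imsetP[y + ->]; rewrite !inE.
  move=> /andP[xj xi] /andP[yj yi].
  move=> fxy; have /fE : complete_graph r.+1 x y.
    by apply: contraNneq fxy => ->.
  rewrite /= /add_edge_rel -fi -fj !(inj_eq f_inj) (negPf xi) (negPf xj).
  by rewrite !andFb andbF orbF.
- move=> _ /imsetP[x + ->]; rewrite !inE => /andP[xj xi].
  have /fE : complete_graph r.+1 x i by [].
  have /fE : complete_graph r.+1 x j by [].
  rewrite /= /add_edge_rel -fi -fj !(inj_eq f_inj) (negPf xi) (negPf xj).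
  rewrite !andFb !andbF !orbF fi fj adj_sym => -> ; rewrite adj_sym => ->.
  by [].
Qed.

Theorem theorem1p3 (R : realType) (r n : nat) (T : finType) (G : sgraph T) :
  (2 <= r)%N -> (r < n)%N -> #|T| = n ->
  saturated (complete_graph r.+1) G ->
  Num.sqrt (((n%:R - 1) ^+ 2 * (r%:R - 1)
             + (r%:R - 1) ^+ 2 * (n%:R - r%:R + 1)) / n%:R)
    <= spectral_radius R G.
Proof.
move=> r_ge2 rn Tn satG.
have n_gt0 : (0 < n)%N by lia.
have [|rho_ge0 rhoP] := @sum_sq_degrees_le R T G; first by rewrite Tn.
(* With [r = k.+2], r - 1 is the [k.+1] of [sum_sq_degrees_ge]. *)
case: r r_ge2 rn satG => [|[|k]] // _ rn satG.
have := sum_sq_degrees_ge R (@adj_sym _ G) (@adj_irr _ G)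
  (fun u v => saturated_completable satG).
rewrite Tn in rhoP *; move=> /le_trans/(_ rhoP) H.
rewrite -[leRHS]ger0_norm // -sqrtr_sqr ler_sqrt ?sqr_ge0 // ler_pdivrMr ?ltr0n //.
apply: le_trans H; rewrite -[k.+2%:R]natr1; lra.
Qed.
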